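(* Let $U_8^{19}=\{L(C)\in TLeib_8 : c_{3,4}=0,\ c_{2,3}=0,\ c_{2,4}\neq 0,\ c_{1,2}\neq 0\}$. 1. Two algebras $L(C)$ and $L(C')$ from $U_8^{19}$ are isomorphic if and only if the following four equalities hold: $$\frac{\left(4c'_{0,0}{c'}_{1,2}^{4}-2c'_{1,3}c'_{0,1}{c'}_{1,2}^{2}+{c'}_{1,3}^{2}c'_{1,1}\right){c'}_{1,2}^{3}}{{c'}_{2,4}^{6}}=\frac{\left(4c_{0,0}c_{1,2}^4-2c_{1,3}c_{0,1}c_{1,2}^2+c_{1,3}^2c_{1,1}\right)c_{1,2}^3}{c_{2,4}^6},$$ $$\frac{\left(-c'_{1,3}c'_{1,1}+c'_{0,1}{c'}_{1,2}^{2}\right){c'}_{1,2}^{3}}{{c'}_{2,4}^{5}}=\frac{\left(-c_{1,3}c_{1,1}+c_{0,1}c_{1,2}^2\right)c_{1,2}^3}{c_{2,4}^5},\qquad \frac{{c'}_{1,2}^{3}c'_{1,1}}{{c'}_{2,4}^{4}}=\frac{c_{1,2}^3c_{1,1}}{c_{2,4}^4},$$ $$\frac{4c'_{1,4}c'_{1,2}-5{c'}_{1,3}^{2}}{{c'}_{2,4}^{2}}=\frac{4c_{1,4}c_{1,2}-5c_{1,3}^2}{c_{2,4}^2}.$$ 2. For any $\lambda_1,\lambda_2,\lambda_3,\lambda_4\in\mathbb{C}$ there exists $L(C)\in U_8^{19}$ with $$\frac{\left(4c_{0,0}c_{1,2}^4-2c_{1,3}c_{0,1}c_{1,2}^2+c_{1,3}^2c_{1,1}\right)c_{1,2}^3}{c_{2,4}^6}=\lambda_1,\quad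 \frac{\left(-c_{1,3}c_{1,1}+c_{0,1}c_{1,2}^2\right)c_{1,2}^3}{c_{2,4}^5}=\lambda_2,\quad \frac{c_{1,2}^3c_{1,1}}{c_{2,4}^4}=\lambda_3,\quad \frac{4c_{1,4}c_{1,2}-5c_{1,3}^2}{c_{2,4}^2}=\lambda_4.$$ Moreover, the orbits (isomorphism classes) in $U_8^{19}$ are parameterized by the algebras $L(\lambda_1,\lambda_2,\lambda_3,1,0,\lambda_4,0,0,1,0)$, $\lambda_1,\lambda_2,\lambda_3,\lambda_4\in\mathbb{C}$: these algebras lie in $U_8^{19}$ and every algebra in $U_8^{19}$ is isomorphic to one of them.
   Context: All algebras are over $\mathbb{C}$. For $C=(c_{0,0},c_{0,1},c_{1,1},c_{1,2},c_{1,3},c_{1,4},c_{1,5},c_{2,3},c_{2,4},c_{3,4})\in\mathbb{C}^{10}$, $L(C)$ denotes the $8$-dimensional complex algebra with basis $e_0,\dots,e_7$ and products (products of basis vectors not listed are zero): $[e_i,e_0]=e_{i+1}$ for $1\le i\le 6$; $[e_0,e_i]=-e_{i+1}$ for $2\le i\le 6$; $[e_0,e_0]=c_{0,0}e_7$; $[e_0,e_1]=-e_2+c_{0,1}e_7$; $[e_1,e_1]=c_{1,1}e_7$; $[e_1,e_2]=-[e_2,e_1]=c_{1,2}e_4+c_{1,3}e_5+c_{1,4}e_6+c_{1,5}e_7$; $[e_1,e_3]=-[e_3,e_1]=c_{1,2}e_5+c_{1,3}e_6+c_{1,4}e_7$; $[e_1,e_4]=-[e_4,e_1]=(c_{1,2}-c_{2,3})e_6+(c_{1,3}-c_{2,4})e_7$;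 $[e_1,e_5]=-[e_5,e_1]=(c_{1,2}-2c_{2,3})e_7$; $[e_2,e_3]=-[e_3,e_2]=c_{2,3}e_6+c_{2,4}e_7$; $[e_2,e_4]=-[e_4,e_2]=c_{2,3}e_7$; $[e_i,e_{7-i}]=-[e_{7-i},e_i]=(-1)^ic_{3,4}e_7$ for $1\le i\le 6$. $TLeib_8$ is the set of all $L(C)$ with $c_{3,4}(c_{2,3}+2c_{1,2})=0$ (the condition for $L(C)$ to be a Leibniz algebra, i.e. to satisfy $[x,[y,z]]=[[x,y],z]-[[x,z],y]$). The entries of $C'$ are denoted $c'_{i,j}$, in the same order. ''Isomorphic'' means isomorphic as algebras over $\mathbb{C}$; an orbit is an isomorphism class. *)

(* Defs.v *)
From HB Require Import structures.
From mathcomp Require Import all_boot all_order all_algebra.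
From mathcomp Require Export reals complex.

Set Implicit Arguments.
Unset Strict Implicit.
Unset Printing Implicit Defensive.

Import GRing.Theory.

Record params (K : Type) := Params {
  c00 : K; c01 : K; c11 : K; c12 : K; c13 : K;
  c14 : K; c15 : K; c23 : K; c24 : K; c34 : K }.

Section Algebra.

Local Open Scope nat_scope.

Variable K : fieldType.
Implicit Types (C : params K) (i j k : nat).

(* Only meaningful for k <= 7, since inord sends larger k to 0. *)
Definition e k : 'rV[K]_8 := delta_mx ord0 (inord k).

(* [e_i, e_j] for 1 <= i < j; the lines with i + j = 7 in which only c34
   occurs come from [e_i, e_{7-i}] = (-1)^i c34 e_7. *)
Definition bracket_lt C i j : 'rV[K]_8 :=
  match i, j with
  | 1, 2 => (c12 C *: e 4 + c13 C *: e 5 + c14 C *: e 6 + c15 C *: e 7)%R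
  | 1, 3 => (c12 C *: e 5 + c13 C *: e 6 + c14 C *: e 7)%R
  | 1, 4 => ((c12 C - c23 C) *: e 6 + (c13 C - c24 C) *: e 7)%R
  | 1, 5 => ((c12 C - 2 * c23 C) *: e 7)%R
  | 1, 6 => (- c34 C *: e 7)%R
  | 2, 3 => (c23 C *: e 6 + c24 C *: e 7)%R
  | 2, 4 => (c23 C *: e 7)%R
  | 2, 5 => (c34 C *: e 7)%R
  | 3, 4 => (- c34 C *: e 7)%R
  | _, _ => 0%R
  end.

Definition bracket C i j : 'rV[K]_8 :=
  match i, j with
  | 0, 0 => (c00 C *: e 7)%R
  | 0, 1 => (- e 2 + c01 C *: e 7)%R
  | 1, 1 => (c11 C *: e 7)%R
  | 0, _ => if j <= 6 then (- e j.+1)%R else 0%R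
  | _, 0 => if i <= 6 then e i.+1 else 0%R
  | _, _ => if i < j then bracket_lt C i j else (- bracket_lt C j i)%R
  end.

Local Open Scope ring_scope.

Definition L C (x y : 'rV[K]_8) : 'rV[K]_8 :=
  \sum_(i < 8) \sum_(j < 8) (x ord0 i * y ord0 j) *: bracket C i j.

Definition isomorphic (m m' : 'rV[K]_8 -> 'rV[K]_8 -> 'rV[K]_8) : Prop :=
  exists f : {linear 'rV[K]_8 -> 'rV[K]_8},
    bijective f /\ forall x y, f (m x y) = m' (f x) (f y).

(* The sets of algebras L C are given as predicates on the parameters C
   (L is injective). *)
Definition TLeib8 C : Prop := c34 C * (c23 C + 2 * c12 C) = 0.

Definition U8_19 C : Prop :=
  [/\ TLeib8 C, c34 C = 0, c23 C = 0, c24 C != 0 & c12 C != 0].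

Definition inv1 C : K :=
  (4 * c00 C * c12 C ^+ 4 - 2 * c13 C * c01 C * c12 C ^+ 2
     + c13 C ^+ 2 * c11 C) * c12 C ^+ 3 / c24 C ^+ 6.

Definition inv2 C : K :=
  (- (c13 C * c11 C) + c01 C * c12 C ^+ 2) * c12 C ^+ 3 / c24 C ^+ 5.

Definition inv3 C : K := c12 C ^+ 3 * c11 C / c24 C ^+ 4.

Definition inv4 C : K :=
  (4 * c14 C * c12 C - 5 * c13 C ^+ 2) / c24 C ^+ 2.

End Algebra.

(* Main.v *)
From HB Require Import structures.
Require Import Defs.
From mathcomp Require Import all_boot all_order all_algebra ring.
Set Implicit Arguments.
Unset Strict Implicit.
Unset Printing Implicit Defensive.
Import GRing.Theory Num.Theory.

Local Open Scope ring_scope.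

(** Every algebra of the family can be brought, by three triangular changes of
    basis, to the normal form with parameters
    [(inv1 / 4, inv2, inv3, 1, 0, inv4 / 4, 0, 0, 1, 0)], and two normal forms
    are isomorphic only if they coincide. Both directions of the criterion
    follow, as does the list of representatives; no invariance of the [inv]s
    under general isomorphisms has to be checked directly.

    Reduction ([iso_normal_form]). Replacing [e_0] by [e_0 + B e_1]
    ([iso_shear]) adds [2 c12^2 B] to [c13], so [c13] can be made zero;
    replacing [e_1] by [e_1 + t e_3] ([iso_kill_c15]) subtracts [2 t c24] from
    [c15] and changes no other parameter, so [c15] can be made zero; replacing
    [e_0, e_1] by [A e_0, D e_1] ([iso_scale]) multiplies [c12] by [D / A^2]
    and [c24] by [D / A^3], so both can be made one. What is left of [c00],
    [c01], [c11], [c14] is given by the four rational functions of the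
    statement, up to the factors 4.

    Rigidity ([normal_form_inj]). An isomorphism [f] is determined by
    [x = f e_0] and [y = f e_1], because [e_{i+1} = [e_i, e_0]] for [i >= 1];
    in particular it is triangular from [e_2] on, with diagonal entries
    [delta, delta x_0, delta x_0^2] and so on ([prod_crd_flag]). Between
    normal forms, the absence of [e_3] from [[e_1, e_2]] forces [y_0 = 0], the
    coefficients 1 of [e_4] in [[e_1, e_2]] and of [e_7] in [[e_2, e_3]] force
    [x_0 = y_1 = 1], the coefficient 0 of [e_5] in [[e_1, e_2]] forces
    [x_1 = 0], and the four remaining parameters are then equal. *)

(** * The product in coordinates *)

Section Coordinates.

Variable K : fieldType.
Implicit Types (x y : 'rV[K]_8) (X Y : nat -> K) (C : params K).

Definition crd x (k : nat) : K := x ord0 (inord k).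

Lemma sum8 (V : nmodType) (F : 'I_8 -> V) :
  \sum_i F i = F (inord 0) + F (inord 1) + F (inord 2) + F (inord 3)
             + F (inord 4) + F (inord 5) + F (inord 6) + F (inord 7).
Proof.
rewrite !big_ord_recr big_ord0 /= add0r.
by do !congr (_ + _); congr F; apply: val_inj; exact/esym/inordK.
Qed.

Lemma forall_lt8 (P : nat -> Prop) :
  P 0 -> P 1 -> P 2 -> P 3 -> P 4 -> P 5 -> P 6 -> P 7 ->
  forall k, (k < 8)%N -> P k.
Proof. by move=> ? ? ? ? ? ? ? ? k; do 8![case: k => [|k] //]. Qed.

Lemma crd_inj x y : (forall k, (k < 8)%N -> crd x k = crd y k) -> x = y.
Proof.
move=> eqxy; apply/rowP => j.
by have := eqxy j (ltn_ord j); rewrite /crd inord_val.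
Qed.

Lemma crd_e i k : (i < 8)%N -> (k < 8)%N -> crd (e K i) k = (k == i)%:R.
Proof. by move=> i8 k8; rewrite /crd mxE eqxx -val_eqE /= !inordK. Qed.

Lemma crd0 k : crd 0 k = 0. Proof. by rewrite /crd mxE. Qed.

Lemma crdD x y k : crd (x + y) k = crd x k + crd y k.
Proof. by rewrite /crd mxE. Qed.

Lemma crdN x k : crd (- x) k = - crd x k.
Proof. by rewrite /crd mxE. Qed.

Lemma crdZ a x k : crd (a *: x) k = a * crd x k.
Proof. by rewrite /crd mxE. Qed.

Definition crdE := (crdD, crdN, crdZ, crd0).

Definition minor X Y i j : K := X i * Y j - X j * Y i.

(** The coordinates of the product of [L C] when [c23] and [c34] vanish: an
    alternating part, plus a bilinear form in the first two coordinates with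
    values in the line of [e_7]. *)
Definition prod_crd C X Y : seq K :=
  [:: 0; 0; minor X Y 1 0; minor X Y 2 0;
    minor X Y 3 0 + c12 C * minor X Y 1 2;
    minor X Y 4 0 + c13 C * minor X Y 1 2 + c12 C * minor X Y 1 3;
    minor X Y 5 0 + c14 C * minor X Y 1 2 + c13 C * minor X Y 1 3
      + c12 C * minor X Y 1 4;
    minor X Y 6 0 + c15 C * minor X Y 1 2 + c14 C * minor X Y 1 3
      + (c13 C - c24 C) * minor X Y 1 4 + c12 C * minor X Y 1 5
      + c24 C * minor X Y 2 3
      + c00 C * (X 0 * Y 0) + c01 C * (X 0 * Y 1) + c11 C * (X 1 * Y 1)].

Lemma crd_L C x y k : c23 C = 0 -> c34 C = 0 -> (k < 8)%N ->
  crd (L C x y) k = (prod_crd C (crd x) (crd y))`_k.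
Proof.
move=> c23E c34E; move: k.
rewrite /L sum8 !sum8 -!/(crd _ _) !inordK //= c23E c34E.
(* Most of the 64 terms vanish; dropping them before taking coordinates keeps
   the rewriting feasible. *)
rewrite !(mulr0, subr0, oppr0, scale0r, scaler0, addr0, add0r).
by apply: forall_lt8; rewrite /= !crdE !crd_e //= /minor; ring.
Qed.

Lemma L_e C i j : (i < 8)%N -> (j < 8)%N -> L C (e K i) (e K j) = bracket C i j.
Proof.
move=> i8 j8; rewrite /L (bigD1 (inord i)) //= [X in _ + X]big1; last first.
  by move=> i' neq; apply: big1 => j' _; rewrite mxE (negPf neq) mul0r scale0r.
rewrite addr0 (bigD1 (inord j)) //= [X in _ + X]big1; last first.
  by move=> j' neq; rewrite [e K j _ _]mxE (negPf neq) mulr0 scale0r.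
by rewrite addr0 !mxE !eqxx mulr1 scale1r !inordK.
Qed.

End Coordinates.

(** * Isomorphisms given by triangular changes of basis *)

Section ChangeOfBasis.

Variable K : fieldType.
Implicit Types (m : 'rV[K]_8 -> 'rV[K]_8 -> 'rV[K]_8) (C : params K).
Implicit Types (rows : seq (seq K)) (X Y : nat -> K).

Lemma isomorphic_sym m m' : isomorphic m m' -> isomorphic m' m.
Proof.
case=> f [[g fK gK] homf].
have glin : linear g.
  by move=> a u v; apply: (can_inj fK); rewrite linearP !gK.
pose G := GRing.isLinear.Build K _ _ _ g glin.
pose gL : {linear 'rV[K]_8 -> 'rV[K]_8} := HB.pack g G.
exists gL; split; first by exists f.
by move=> x y; apply: (can_inj fK); rewrite homf /= !gK.
Qed.

Lemma isomorphic_trans m1 m2 m3 :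
  isomorphic m1 m2 -> isomorphic m2 m3 -> isomorphic m1 m3.
Proof.
move=> [f [fbij fhom]] [g [gbij ghom]].
exists (g \o f : {linear _ -> _}); split; first exact: bij_comp.
by move=> x y /=; rewrite fhom ghom.
Qed.

Definition mx_of_rows rows : 'M[K]_8 := \matrix_(i, j) (nth [::] rows i)`_j.

Definition rows_map rows X (k : nat) : K :=
    X 0 * (nth [::] rows 0)`_k + X 1 * (nth [::] rows 1)`_k
  + X 2 * (nth [::] rows 2)`_k + X 3 * (nth [::] rows 3)`_k
  + X 4 * (nth [::] rows 4)`_k + X 5 * (nth [::] rows 5)`_k
  + X 6 * (nth [::] rows 6)`_k + X 7 * (nth [::] rows 7)`_k.

Lemma crd_mulmx x rows k : (k < 8)%N ->
  crd (x *m mx_of_rows rows) k = rows_map rows (crd x) k.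
Proof. by move=> k8; rewrite /crd mxE sum8 !mxE !inordK. Qed.

(** Row [i] holds the image of the [i]th basis vector of [L C'] in [L C];
    triangularity makes the change of basis invertible, and comparing
    coordinates turns multiplicativity into eight polynomial identities. *)
Lemma iso_of_rows C C' rows :
    [/\ c23 C = 0, c34 C = 0, c23 C' = 0 & c34 C' = 0] ->
    (forall i, (i < 8)%N -> forall j, (j < i)%N -> (nth [::] rows i)`_j = 0) ->
    (forall i, (i < 8)%N -> (nth [::] rows i)`_i != 0) ->
    (forall X Y k, (k < 8)%N ->
       rows_map rows (nth 0 (prod_crd C' X Y)) k =
       (prod_crd C (rows_map rows X) (rows_map rows Y))`_k) ->
  isomorphic (L C) (L C').
Proof.
move=> [c23C c34C c23C' c34C'] trig diag hom; apply: isomorphic_sym.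
pose M := mx_of_rows rows.
have unitM : M \in unitmx.
  have trigM : is_trig_mx M^T.
    by apply/is_trig_mxP => i j ltij; rewrite !mxE trig.
  rewrite unitmxE unitfE -det_tr (det_trig trigM).
  by apply/prodf_neq0 => i _; rewrite !mxE diag.
exists (mulmxr M); split.
  by exists (mulmxr (invmx M)) => x /=; rewrite ?mulmxK ?mulmxKV.
move=> x y; apply: crd_inj => k k8.
have prodM k' : (k' < 8)%N ->
    (prod_crd C (crd (x *m M)) (crd (y *m M)))`_k' =
    (prod_crd C (rows_map rows (crd x)) (rows_map rows (crd y)))`_k'.
  by move: k'; apply: forall_lt8; rewrite /= /minor ?crd_mulmx.
rewrite /= crd_mulmx // crd_L // prodM // -hom //.
by rewrite /rows_map !crd_L.
Qed.

(** The change of basis [e_0 -> e_0 + B e_1]. The rows from the third on are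
    forced, each being the product of the preceding one with the first. The
    new [c15] is left unspecified because [iso_kill_c15] removes it. *)
Lemma iso_shear (p q r a b c d s B : K) :
  exists d' : K,
    isomorphic (L (Params p q r a b c d 0 s 0))
      (L (Params (p + q * B + r * B ^+ 2) (q + 2 * r * B) r
            a (b + 2 * a ^+ 2 * B)
            (c + 5 * a * b * B + 5 * a ^+ 3 * B ^+ 2) d' 0 s 0)).
Proof.
exists (d + 2 * a * c * B - (2 * a ^+ 2 * b - a ^+ 2 * s) * B ^+ 2
  - (b + 2 * a ^+ 2 * B) * (- 3 * b * B + s * B + 3 * a ^+ 2 * B ^+ 2)
  + 4 * a * B * (c + 5 * a * b * B + 5 * a ^+ 3 * B ^+ 2)).
apply: (@iso_of_rows _ _
 [:: [:: 1; B; 0; 0; 0; 0; 0; 0];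
     [:: 0; 1; 0; 0; 0; 0; 0; 0];
     [:: 0; 0; 1; 0; 0; 0; 0; r * B];
     [:: 0; 0; 0; 1; - a * B; - b * B; - c * B; - d * B];
     [:: 0; 0; 0; 0; 1; - 2 * a * B; - 2 * b * B + a ^+ 2 * B ^+ 2;
         - 2 * c * B + (2 * a * b - a * s) * B ^+ 2];
     [:: 0; 0; 0; 0; 0; 1; - 3 * a * B;
         - 3 * b * B + s * B + 3 * a ^+ 2 * B ^+ 2];
     [:: 0; 0; 0; 0; 0; 0; 1; - 4 * a * B];
     [:: 0; 0; 0; 0; 0; 0; 0; 1]]) => //.
- by apply: forall_lt8 => // -[|[|[|[|[|[|[|j]]]]]]].
- by apply: forall_lt8; rewrite /= oner_neq0.
by move=> X Y; apply: forall_lt8; rewrite /rows_map /prod_crd /minor /=; ring.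
Qed.

(** The change of basis [e_1 -> e_1 + t e_3]. Since [[e_1, e_4]] has
    coefficient [c13 - c24] on [e_7] while [[e_1, e_2]] has coefficient [c13]
    on [e_5], and since [[e_3, e_2] = - c24 e_7], the shift changes [c15] by
    [- 2 t c24]; this is where [c24 != 0] matters. *)
Lemma iso_kill_c15 (p q r a b c d s : K) :
  2 != 0 :> K -> s != 0 ->
  isomorphic (L (Params p q r a b c d 0 s 0))
    (L (Params p q r a b c 0 0 s 0)).
Proof.
move=> nz2 nzs; pose t := d / (2 * s).
have -> : d = 2 * t * s by rewrite /t; field; apply/andP.
apply: (@iso_of_rows _ _
 [:: [:: 1; 0; 0; 0; 0; 0; 0; 0];
     [:: 0; 1; 0; t; 0; 0; 0; 0];
     [:: 0; 0; 1; 0; t; 0; 0; 0];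
     [:: 0; 0; 0; 1; 0; t; 0; 0];
     [:: 0; 0; 0; 0; 1; 0; t; 0];
     [:: 0; 0; 0; 0; 0; 1; 0; t];
     [:: 0; 0; 0; 0; 0; 0; 1; 0];
     [:: 0; 0; 0; 0; 0; 0; 0; 1]]) => //.
- by apply: forall_lt8 => // -[|[|[|[|[|[|[|j]]]]]]].
- by apply: forall_lt8; rewrite /= oner_neq0.
by move=> X Y; apply: forall_lt8; rewrite /rows_map /prod_crd /minor /=; ring.
Qed.

(** The change of basis [e_0 -> A e_0], [e_1 -> D e_1]: the basis vector [e_i],
    for [i >= 1], gets weight [D A^(i-1)], and each structure constant scales
    by the quotient of the weights involved. *)
Lemma iso_scale (p q r a b c d s A D : K) :
  A != 0 -> D != 0 ->
  isomorphic (L (Params p q r a b c d 0 s 0))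
    (L (Params (p / (D * A ^+ 4)) (q / A ^+ 5) (r * D / A ^+ 6)
         (a * D / A ^+ 2) (b * D / A ^+ 3) (c * D / A ^+ 4) (d * D / A ^+ 5)
         0 (s * D / A ^+ 3) 0)).
Proof.
move=> nzA nzD.
apply: (@iso_of_rows _ _
 [:: [:: A; 0; 0; 0; 0; 0; 0; 0];
     [:: 0; D; 0; 0; 0; 0; 0; 0];
     [:: 0; 0; D * A; 0; 0; 0; 0; 0];
     [:: 0; 0; 0; D * A ^+ 2; 0; 0; 0; 0];
     [:: 0; 0; 0; 0; D * A ^+ 3; 0; 0; 0];
     [:: 0; 0; 0; 0; 0; D * A ^+ 4; 0; 0];
     [:: 0; 0; 0; 0; 0; 0; D * A ^+ 5; 0];
     [:: 0; 0; 0; 0; 0; 0; 0; D * A ^+ 6]]) => //.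
- by apply: forall_lt8 => // -[|[|[|[|[|[|[|j]]]]]]].
- by apply: forall_lt8; rewrite /= ?mulf_neq0 ?expf_neq0.
move=> X Y; apply: forall_lt8; rewrite /rows_map /prod_crd /minor /=;
  by field; rewrite ?nzA ?nzD.
Qed.

End ChangeOfBasis.

(** * Normal forms *)

Section NormalForm.

Variable K : fieldType.

Definition normal_form (l1 l2 l3 l4 : K) := Params l1 l2 l3 1 0 l4 0 0 1 0.

Lemma iso_normal_form (C : params K) : 2 != 0 :> K -> U8_19 C ->
  isomorphic (L C)
    (L (normal_form (inv1 C / 4) (inv2 C) (inv3 C) (inv4 C / 4))).
Proof.
move=> nz2; case: C => p q r a b c d t s u [_ /= -> -> nzs nza].
have nz4 : 4 != 0 :> K by rewrite (natrM _ 2 2) mulf_neq0.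
(* The root [B] of [c13 + 2 c12^2 B]. *)
have [d' iso_b] := iso_shear p q r a b c d s (- b / (2 * a ^+ 2)).
apply: (isomorphic_trans iso_b).
apply: (isomorphic_trans (iso_kill_c15 _ _ _ _ _ _ _ nz2 nzs)).
(* The solution of [a D / A^2 = 1] and [s D / A^3 = 1] is [A = s / a],
   [D = s^2 / a^3]. *)
have nzA : s / a != 0 by rewrite mulf_neq0 ?invr_eq0.
have nzD : s ^+ 2 / a ^+ 3 != 0 by rewrite mulf_neq0 ?invr_eq0 ?expf_neq0.
apply: (eq_ind _ (fun C => isomorphic _ (L C))
  (iso_scale _ _ _ _ _ _ _ _ nzA nzD)).
rewrite /normal_form /inv1 /inv2 /inv3 /inv4 /=.
by congr Params; field; rewrite ?nzs ?nza ?nz2 ?nz4.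
Qed.

(** Right multiplication by any element moves the span of [e_m, ..., e_7] one
    step down; its action on leading coefficients depends only on the
    coordinate along [e_0], since multiplying by [e_1] moves two steps down. *)
Lemma prod_crd_flag (C : params K) (W X : nat -> K) m :
    (1 < m < 7)%N -> (forall k, (k < m)%N -> W k = 0) ->
  (forall k, (k < m.+1)%N -> (prod_crd C W X)`_k = 0)
  /\ (prod_crd C W X)`_m.+1 = W m * X 0.
Proof.
case: m => [|[|[|[|[|[|[|m]]]]]]] // _ W0; split;
  try case=> [|[|[|[|[|[|[|k]]]]]]] //= _; rewrite /= /minor;
  repeat match goal with |- context [W ?k] => rewrite (W0 k isT) end; by ring.
Qed.

Lemma eq_by_sub (a b u v : K) : u = v -> a - b = u - v -> a = b.
Proof. by move=> -> /eqP; rewrite subrr subr_eq0 => /eqP. Qed.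

(** The parameters of a normal form can be read off from its isomorphism
    class: apart from terms of higher index, an isomorphism between normal
    forms fixes [e_0] and [e_1]. *)
Lemma normal_form_inj (l1 l2 l3 l4 l1' l2' l3' l4' : K) : 2 != 0 :> K ->
  isomorphic (L (normal_form l1 l2 l3 l4)) (L (normal_form l1' l2' l3' l4')) ->
  [/\ l1' = l1, l2' = l2, l3' = l3 & l4' = l4].
Proof.
set N := normal_form l1 l2 l3 l4; set N' := normal_form l1' l2' l3' l4'.
move=> nz2 [f [fbij homf]].
pose v i := crd (f (e K i)).
have prodE i j k : (i < 8)%N -> (j < 8)%N -> (k < 8)%N ->
    crd (f (bracket N i j)) k = (prod_crd N' (v i) (v j))`_k.
  by move=> i8 j8 k8; rewrite -L_e // homf crd_L.
have vS m k : (0 < m < 7)%N -> (k < 8)%N ->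
    v m.+1 k = (prod_crd N' (v m) (v 0))`_k.
  move=> m_bnd k8; rewrite -prodE //; last by case/andP: m_bnd => _ /ltnW.
  by case: m m_bnd => [|[|[|[|[|[|[|m]]]]]]].
pose x := v 0; pose y := v 1; pose delta := v 2 2.
have flag m : (m < 6)%N -> (forall k, (k < m.+2)%N -> v m.+2 k = 0)
    /\ v m.+2 m.+2 = delta * x 0 ^+ m.
  elim: m => [_|m IHm m6].
    split; last by rewrite expr0 mulr1.
    by case=> [|[|k]] // _; rewrite vS.
  have [vm0 vmm] := IHm (ltnW m6).
  have [vSm0 vSmm] := @prod_crd_flag N' (v m.+2) x m.+2 m6 vm0.
  split=> [k ltkm|]; last by rewrite vS // vSmm vmm exprSr mulrA.
  by rewrite vS ?vSm0 // (leq_trans ltkm) // (leqW (m6 : m.+3 <= 7)%N).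
have [[v20 v21] [v30 v31 v32 v33]] : (v 2 0 = 0 /\ v 2 1 = 0) /\
    [/\ v 3 0 = 0, v 3 1 = 0, v 3 2 = 0 & v 3 3 = delta * x 0].
  have [v2 _] := flag 0 isT; have [v3 v33] := flag 1 isT.
  by split; split; rewrite ?v33 ?expr1 ?v2 ?v3.
have [v4 v44] := flag 2 isT.
have [v6 v66] := flag 4 isT; have [v7 v77] := flag 5 isT.
(* All other coordinates of [f e_7] vanish, so this one cannot. *)
have v77_neq0 : delta * x 0 ^+ 5 != 0.
  rewrite -v77; apply/eqP => v770.
  have fe7 : f (e K 7) = 0.
    apply: crd_inj => k; rewrite crd0 -/(v 7 k) ltnS leq_eqVlt.
    by case/predU1P=> [-> //|/v7].
  have := crd_e K (isT : 7 < 8)%N (isT : 7 < 8)%N.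
  have -> : e K 7 = 0 by apply: (bij_inj fbij); rewrite fe7 linear0.
  by rewrite crd0 => /esym/eqP; rewrite oner_eq0.
have [nzdelta nzx0] : delta != 0 /\ x 0 != 0.
  by move: v77_neq0; rewrite mulf_eq0 expf_eq0 negb_or => /andP[].
have prod12 k : (k < 8)%N ->
    v 4 k + l4 * v 6 k = (prod_crd N' y (v 2))`_k.
  move=> k8; rewrite -prodE //= !linearD !linearZ /= !crdE -!/(v _ _); ring.
have prod23 : v 7 7 = (prod_crd N' (v 2) (v 3))`_7.
  by rewrite -prodE //= !linearD !linearZ /= !crdE -!/(v _ _); ring.
have y0 : y 0 = 0.
  have := prod12 3 isT; rewrite v4 // v6 // /= /minor v20 !mulr0.
  rewrite addr0 sub0r => /esym/eqP.
  by rewrite oppr_eq0 mulf_eq0 (negPf nzdelta) orbF => /eqP.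
have deltaE : delta = y 1 * x 0.
  by rewrite /delta vS //= /minor -/y -/x y0 mul0r subr0.
have y1E : y 1 = x 0 ^+ 2.
  apply: (mulfI nzdelta); have := prod12 4 isT.
  rewrite v44 v6 // /= /minor v20 v21 y0 -/delta => eq4.
  by transitivity (delta * x 0 ^+ 2 + l4 * 0); [rewrite eq4|]; ring.
have x0 : x 0 = 1.
  have nz : delta * x 0 ^+ 4 != 0 by rewrite mulf_neq0 ?expf_neq0.
  apply: (mulfI nz); transitivity (v 7 7); first by rewrite v77; ring.
  rewrite prod23 /= /minor v20 v21 v30 v31 v32 v33 -/delta.
  transitivity (delta * (delta * x 0)); first by ring.
  by rewrite {2}deltaE y1E; ring.
have y1 : y 1 = 1 by rewrite y1E x0 expr1n.
have delta1 : delta = 1 by rewrite deltaE y1 x0 mulr1.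
have v771 : v 7 7 = 1 by rewrite v77 delta1 x0 expr1n mulr1.
have v34 : v 3 4 = v 2 3 - x 1.
  rewrite vS //= /minor -/x x0 v20 v21 -/delta delta1; ring.
(* The coefficient of [e_5] in [f e_4] exceeds that of [e_3] in [f e_2] by
   [- 2 x_1], while [c13 = 0] on both sides makes them equal. *)
have x1 : x 1 = 0.
  have := prod12 5 isT; rewrite v6 // [v 4 5]vS //= /minor -/x.
  rewrite v30 v31 v33 v34 v20 v21 y0 y1 -/delta delta1 x0 => eq5.
  by apply: (mulfI nz2); apply: (eq_by_sub (esym eq5)); ring.
have l4E : l4' = l4.
  have := prod12 6 isT; rewrite v66 [v 4 6]vS //= /minor -/x.
  rewrite [v 3 5]vS //= /minor -/x v30 v31 v33 v20 v21 y0 y1 -/delta delta1 x0 x1.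
  by move=> eq6; apply: (eq_by_sub (esym eq6)); ring.
(* The form with values in the line of [e_7] is preserved, because the first
   two coordinates of [f e_0], [f e_1] and the last one of [f e_7] are now
   those of the identity. *)
have l1E : l1' = l1.
  have := prodE 0 0 7 isT isT isT.
  rewrite /= linearZ /= crdZ -/(v 7 7) v771 /minor -/x x0 x1 => eq7.
  by apply: (eq_by_sub (esym eq7)); ring.
have l3E : l3' = l3.
  have := prodE 1 1 7 isT isT isT.
  rewrite /= linearZ /= crdZ -/(v 7 7) v771 /minor -/y y0 y1 => eq7.
  by apply: (eq_by_sub (esym eq7)); ring.
have l2E : l2' = l2.
  have := prodE 0 1 7 isT isT isT; have := vS 1 7 isT isT.
  rewrite /= linearD linearN linearZ /= !crdE -!/(v _ _) v771 => ->.
  rewrite /= /minor -/x -/y x0 x1 y0 y1 => eq7.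
  by apply: (eq_by_sub (esym eq7)); ring.
by split.
Qed.

End NormalForm.

Theorem proposition2p24 (R : realType) :
  [/\ (forall C C' : params R[i], U8_19 C -> U8_19 C' ->
         isomorphic (L C) (L C') <->
         [/\ inv1 C' = inv1 C, inv2 C' = inv2 C,
             inv3 C' = inv3 C & inv4 C' = inv4 C]),
      (forall l1 l2 l3 l4 : R[i],
         exists C : params R[i],
           U8_19 C /\
           [/\ inv1 C = l1, inv2 C = l2, inv3 C = l3 & inv4 C = l4]),
      (forall l1 l2 l3 l4 : R[i], U8_19 (Params l1 l2 l3 1 0 l4 0 0 1 0))
    & (forall C : params R[i], U8_19 C ->
         exists l1 l2 l3 l4 : R[i],
           isomorphic (L C) (L (Params l1 l2 l3 1 0 l4 0 0 1 0)))].
Proof.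
have nz2 : 2 != 0 :> R[i] by rewrite pnatr_eq0.
have nz4 : 4 != 0 :> R[i] by rewrite pnatr_eq0.
have nfU l1 l2 l3 l4 : U8_19 (Params l1 l2 l3 1 0 l4 0 0 1 0 : params R[i]).
  by split; rewrite /TLeib8 /= ?oner_neq0 ?mul0r.
split=> //.
- move=> C C' UC UC'.
  have isoC := iso_normal_form nz2 UC; have isoC' := iso_normal_form nz2 UC'.
  split=> [isoCC' | [inv1E inv2E inv3E inv4E]].
    have isoN := isomorphic_trans (isomorphic_sym isoC)
      (isomorphic_trans isoCC' isoC').
    have [inv1E -> -> inv4E] := normal_form_inj nz2 isoN.
    by split=> //; apply: (mulIf (invr_neq0 nz4)).
  apply: (isomorphic_trans isoC); apply: isomorphic_sym.
  by rewrite -inv1E -inv2E -inv3E -inv4E.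
- move=> l1 l2 l3 l4; exists (Params (l1 / 4) l2 l3 1 0 (l4 / 4) 0 0 1 0).
  split; first exact: nfU.
  by split; rewrite /inv1 /inv2 /inv3 /inv4 /=; field; rewrite ?nz2 ?nz4.
- move=> C UC; do 4!eexists; exact: iso_normal_form nz2 UC.
Qed.
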